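(* Let $T$ be a finite tree with at least two vertices, let $r\in V(T)$, and let $C_r$ be the configuration $$C_r(v)=\begin{cases}\sigma_T(r)-1,&v=r,\\ 1,&v\ne r\text{ and }\deg_T(v)=1,\\ 0,&\text{otherwise.}\end{cases}$$ Then $S_v(C_r)=0$ for every $v\in V(T)$, and $|C_r|=E_T(r)-1$. In particular, $C_r$ is nonstackable.
   Context: Graphs are finite, simple and undirected; a tree is a nonempty connected acyclic graph; $\mathbb N$ includes $0$; $u\sim v$ denotes adjacency. Pebbling. A configuration on $T$ is a function $C:V(T)\to\mathbb N$; its mass is $|C|=\sum_vC(v)$ and its support is $\{v:C(v)>0\}$. A move $u\to v$ is legal when $u\sim v$ and $C(u)\ge 2$; it replaces $C(u)$ by $C(u)-2$ and $C(v)$ by $C(v)+1$. A configuration is reachable from $C$ if it is obtained by a finite (possibly empty) sequence of legal moves. A configuration is stacked at $r$ when its support is exactly $\{r\}$. $C$ is stackable if, for some vertex $r$, a configuration stacked at $r$ is reachable from $C$; otherwise it is nonstackable. Estimator. With $d_T$ the graph distance, put $$\ell_T(r)=|\{v\ne r:\deg_T(v)=1\}|,\qquad \sigma_T(r)=1+\sum_{\substack{v\in V(T)\\ v=r\text{ or }\deg_T(v)>1}}\deg_T(v)\,2^{d_T(r,v)},\qquad E_T(r)=\sigma_T(r)+\ell_T(r).$$ Messages and scores. For adjacent $v,p$ let $B_{v\mid p}$ be the component containing $v$ after deleting the edge $vp$. It is occupied (with respect to a configuration $C$) if $C$ is not identically zero on it, and empty otherwise. Define $F:\mathbb Z\to\mathbb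 Z$ by $F(x)=2x-3$ for $x\le1$; $F(x)=x/2$ for even $x\ge2$; $F(x)=(x-3)/2$ for odd $x\ge3$. For an occupied branch $B_{v\mid p}$ define recursively the integer message $$d_{v\to p}=F\Bigl(C(v)+\sum_{\substack{u\sim v,\ u\ne p\\ B_{u\mid v}\text{ occupied}}}d_{u\to v}\Bigr).$$ Put $\bar d_{v\to p}=d_{v\to p}$ if $B_{v\mid p}$ is occupied and $\bar d_{v\to p}=0$ if it is empty. The score at $v$ is $$S_v(C)=C(v)+\sum_{u\sim v}\bar d_{u\to v}.$$ *)

(* Defs.v *)
From mathcomp Require Import all_boot all_order all_algebra.

Set Implicit Arguments.
Unset Strict Implicit.
Unset Printing Implicit Defensive.

Import GRing.Theory.

(* A finite simple graph is a symmetric irreflexive relation on a finType. *)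

Definition acyclic (T : finType) (e : rel T) : Prop :=
  forall c : seq T, cycle e c -> uniq c -> size c <= 2.

Definition is_tree (T : finType) (e : rel T) : Prop :=
  [/\ symmetric e, irreflexive e, 0 < #|T|,
      forall x y, connect e x y & acyclic e].

Definition deg (T : finType) (e : rel T) (v : T) : nat := #|[set w | e v w]|.

(* A shortest walk has fewer than #|T| edges; on vertices that are not
   connected the value is #|T|. *)
Definition gdist (T : finType) (e : rel T) (x y : T) : nat :=
  find (fun n => [exists p : n.-tuple T, path e x p && (last x p == y)])
       (iota 0 #|T|).

Definition config (T : finType) := {ffun T -> nat}.

Definition mass (T : finType) (C : config T) : nat := \sum_v C v.

Definition supp (T : finType) (C : config T) : {set T} := [set v | 0 < C v].

Definition move (T : finType) (C : config T) (u v : T) : config T :=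
  [ffun x => if x == u then C u - 2 else if x == v then C v + 1 else C x].

Inductive reachable (T : finType) (e : rel T) (C : config T) :
    config T -> Prop :=
| reachable_refl : reachable e C C
| reachable_move D u v :
    reachable e C D -> e u v -> 2 <= D u -> reachable e C (move D u v).

Definition stacked_at (T : finType) (C : config T) (r : T) : Prop :=
  supp C = [set r].

Definition stackable (T : finType) (e : rel T) (C : config T) : Prop :=
  exists r D, reachable e C D /\ stacked_at D r.

Definition nleaves (T : finType) (e : rel T) (r : T) : nat :=
  #|[set v | (v != r) && (deg e v == 1)]|.

Definition sigma (T : finType) (e : rel T) (r : T) : nat :=
  1 + \sum_(v | (v == r) || (1 < deg e v)) deg e v * 2 ^ gdist e r v.

Definition estimator (T : finType) (e : rel T) (r : T) : nat :=
  sigma e r + nleaves e r.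

Definition del_edge (T : finType) (e : rel T) (v p : T) : rel T :=
  [rel x y | e x y && ([set x; y] != [set v; p])].

Definition branch (T : finType) (e : rel T) (v p : T) : {set T} :=
  [set x | connect (del_edge e v p) v x].

Definition occupied (T : finType) (e : rel T) (C : config T) (v p : T) : bool :=
  [exists x in branch e v p, 0 < C x].

(* Both divisions are exact. *)
Definition Fmsg (x : int) : int :=
  if (x <= 1)%R then (2 * x - 3)%R
  else if (2 %| x)%Z then (x %/ 2)%Z else ((x - 3) %/ 2)%Z.

(* The recursion on branches is run with fuel; in a tree branch sizes strictly
   decrease (branch_proper), so #|T| is enough and messages satisfy the intended
   recursive equation message_eq. *)
Fixpoint message_rec (T : finType) (e : rel T) (C : config T)
    (n : nat) (v p : T) : int :=
  if n is n'.+1 then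
    Fmsg ((C v)%:Z +
      \sum_(u | [&& e u v, u != p & occupied e C u v]) message_rec e C n' u v)%R
  else 0%R.

Definition message (T : finType) (e : rel T) (C : config T) (v p : T) : int :=
  message_rec e C #|T| v p.

Definition message0 (T : finType) (e : rel T) (C : config T) (v p : T) : int :=
  if occupied e C v p then message e C v p else 0%R.

Definition score (T : finType) (e : rel T) (C : config T) (v : T) : int :=
  ((C v)%:Z + \sum_(u | e u v) message0 e C u v)%R.

Definition root_config (T : finType) (e : rel T) (r : T) : config T :=
  [ffun v => if v == r then sigma e r - 1
             else if deg e v == 1 then 1 else 0].

Lemma branch_notin (T : finType) (e : rel T) (u v : T) :
  is_tree e -> e u v -> v \notin branch e u v.
Proof.
case=> symE eirr _ _ eacyc euv; rewrite inE; apply/negP => /connectP[p0 pth].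
move=> lastp; case/shortenP: pth lastp => p pth unq _ lastp.
have sub : subrel (del_edge e u v) e by move=> x y /andP[].
have cyc : cycle e (u :: p).
  by rewrite /= rcons_path (sub_path sub pth) -lastp symE.
have := eacyc _ cyc unq; case: p pth lastp {unq cyc} => [|w [|//]] /=.
  by move=> _ vu; rewrite vu eirr in euv.
by move=> /andP[/andP[_ /eqP nE] _] vw _; case: nE; rewrite vw.
Qed.

Lemma branch_proper (T : finType) (e : rel T) (u v p : T) :
  is_tree e -> e u v -> u != p -> branch e u v \proper branch e v p.
Proof.
move=> treeT euv up; have vN := branch_notin treeT euv.
have [symE eirr _ _ _] := treeT.
apply/properP; split; last by exists v => //; rewrite inE connect0.
have vvu : connect (del_edge e v p) v u.
  apply: connect1; rewrite /del_edge /= symE euv /=; apply/eqP => /setP/(_ u).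
  rewrite !inE eqxx orbT (negPf up) orbF => /esym/eqP uv.
  by rewrite uv eirr in euv.
apply/subsetP => x; rewrite !inE => /connectP[s]; elim/last_ind: s x => [|s y IHs] x.
  by move=> _ ->.
rewrite rcons_path last_rcons => /andP[pths lasty] ->.
apply: connect_trans (IHs _ pths erefl) (connect1 _).
have zB : last u s \in branch e u v by rewrite inE; apply/connectP; exists s.
have yB : y \in branch e u v.
  by rewrite inE; apply/connectP; exists (rcons s y); rewrite ?last_rcons // rcons_path pths.
case/andP: lasty => ezy _; rewrite /del_edge /= ezy /=; apply/eqP => /setP/(_ v).
rewrite !inE eqxx /= => /orP[] /eqP vE; first by rewrite -vE (negPf vN) in zB.
by rewrite -vE (negPf vN) in yB.
Qed.

Lemma message_rec_fuel (T : finType) (e : rel T) (C : config T) (m n : nat)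
    (v p : T) :
  is_tree e -> e v p -> #|branch e v p| <= m -> #|branch e v p| <= n ->
  message_rec e C m v p = message_rec e C n v p.
Proof.
move=> treeT; elim: m n v p => [|m IHm] [|n] v p evp //.
- by rewrite leqn0 cards_eq0 => /eqP/setP/(_ v); rewrite !inE connect0.
- by move=> _; rewrite leqn0 cards_eq0 => /eqP/setP/(_ v); rewrite !inE connect0.
move=> lem len /=; congr (Fmsg (_ + _)%R); apply: eq_bigr => u /and3P[euv up _].
have lt := proper_card (branch_proper treeT euv up).
by apply: IHm => //; rewrite -ltnS (leq_trans lt).
Qed.

Lemma message_eq (T : finType) (e : rel T) (C : config T) (v p : T) :
  is_tree e -> e v p ->
  message e C v p =
  Fmsg ((C v)%:Z +
    \sum_(u | [&& e u v, u != p & occupied e C u v]) message e C u v)%R.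
Proof.
move=> treeT evp; have le := max_card (branch e v p).
exact: (message_rec_fuel C treeT evp le (leqW le)).
Qed.

Lemma gdistP (T : finType) (e : rel T) (x y : T) :
  connect e x y ->
  (exists p, [/\ path e x p, last x p = y & size p = gdist e x y]) /\
  (forall p, path e x p -> last x p = y -> gdist e x y <= size p).
Proof.
set P := fun n => [exists p : n.-tuple T, path e x p && (last x p == y)].
have wP q : path e x q -> last x q = y -> P (size q).
  by move=> pq lq; apply/existsP; exists (in_tuple q); rewrite /= pq lq eqxx.
move=> /connectP[p0 pth]; move=> lastp; case/shortenP: pth lastp => p pth unq _ lastp.
have szp : size p < #|T| by have := max_card [in x :: p]; rewrite (card_uniqP unq).
have hasP0 : has P (iota 0 #|T|).
  by apply/hasP; exists (size p); [rewrite mem_iota | apply: wP].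
have lt := hasP0; rewrite has_find size_iota in lt.
split=> [|q pq lq].
  have := nth_find 0 hasP0; rewrite nth_iota // add0n.
  case/existsP => q /andP[pq /eqP lq]; exists q; split=> //.
  by rewrite size_tuple.
rewrite leqNgt; apply/negP => ltq; have := before_find 0 ltq.
rewrite nth_iota ?(ltn_trans ltq) // add0n => Pq.
by have := wP _ pq lq; rewrite /P Pq.
Qed.

(* Main.v *)
Require Import Defs.
From mathcomp Require Import all_boot all_order all_algebra.
From mathcomp Require Import zify ring.

Set Implicit Arguments.
Unset Strict Implicit.
Unset Printing Implicit Defensive.

Import Order.TTheory GRing.Theory Num.Theory.

(** Write C for the configuration of the theorem and B(v|p) for the branch at v
    away from its neighbour p.

    Scores vanish. Every branch is occupied, because it contains r or a leaf.
    Let m be the message from v to p when r is not in B(v|p). Each input to F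
    on the way up is at most 1, so only the clause F(x) = 2x - 3 is used, and
    multiplying by 2^d(r,v) turns the recursion into a sum over the branch:
      2^d(r,v) m = - (2^d(r,v) + 2 * sum of deg(w) 2^d(r,w)),
    w ranging over the vertices of B(v|p) of degree more than 1
    ([message_away]). Adding this over the neighbours of r gives exactly
    -(sigma(r) - 1), hence the score of r is 0 ([score_root]). A zero score
    then passes from a vertex p to its child v: the messages other than the one
    from v sum, with C(p), to - F(X), where X is what v feeds into its own
    message, so the score of v is X + F(- F(X)), which is 0 as X <= 1
    ([FmsgNK], [score_away]).

    Nonstackability. It suffices that no move increases any score
    ([score_move]): a configuration D stacked at t has score D(t) > 0 at t. The
    function F is not monotone, F(2) > F(3), but it becomes so for the order
    in which x dominates y when x - y is a nonnegative multiple of 3, because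
    F(x + 3) - F(x) is 0, 3 or 6. This order loses nothing: F(x) = - x modulo
    3, so a move changes all scores by multiples of 3. Induction on branches
    ([message0_move]) shows that messages across edges other than that of the
    move are dominated by their former values, while across the edge ab of a
    move from a to b the message from a drops by at least 1 and the one from b
    grows by at most 2. These are precisely the amounts that compensate the
    pebble gained by b and the two lost by a. *)

(** * Branches of a tree *)

Lemma tree_edge_neq (T : finType) (e : rel T) (u v : T) :
  is_tree e -> e u v -> u != v.
Proof. by case=> _ eirr _ _ _; apply: contraTneq => ->; rewrite eirr. Qed.

Lemma branch_self (T : finType) (e : rel T) (v p : T) : v \in branch e v p.
Proof. by rewrite inE connect0. Qed.

(** Deleting an edge cuts the tree only there: the sole way out of a branch is
    through the deleted edge. *)
Lemma branch_exit (T : finType) (e : rel T) (v p x y : T) :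
  is_tree e -> e x y -> x \in branch e v p -> y \notin branch e v p ->
  x = v /\ y = p.
Proof.
move=> treeT exy xB yB.
have /setP E : [set x; y] = [set v; p].
  apply/eqP; apply: contraNT yB => nE.
  move: xB; rewrite !inE => /connect_trans-> //.
  by apply: connect1; rewrite /del_edge /= exy.
have yp : y = p.
  have := E y; rewrite !inE eqxx orbT => /esym/orP[]/eqP // yv.
  by rewrite yv branch_self in yB.
split=> //; have := E x; rewrite !inE eqxx => /esym/orP[]/eqP // xp.
by have := tree_edge_neq treeT exy; rewrite xp yp eqxx.
Qed.

(** The vertices reached so far on a walk from v are v itself or lie in some
    branch at v, since such a branch can be left only through v. *)
Lemma branch_cover (T : finType) (e : rel T) (v w : T) :
  is_tree e -> w != v -> exists2 u, e u v & w \in branch e u v.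
Proof.
move=> treeT wv; have [symE _ _ conn _] := treeT.
suff [/eqP|//] : w = v \/ exists2 u, e u v & w \in branch e u v.
  by rewrite (negPf wv).
have /connectP[s] := conn v w; elim/last_ind: s w {wv} => [|s y IHs] w /=.
  by move=> _ ->; left.
rewrite rcons_path last_rcons => /andP[pths exy] ->.
have [xv|[u euv xB]] := IHs _ pths erefl.
  by right; exists y; [rewrite symE -xv | apply: branch_self].
have [yB|yB] := boolP (y \in branch e u v); first by right; exists u.
by left; have [] := branch_exit treeT exy xB yB.
Qed.

Lemma branch_compl (T : finType) (e : rel T) (v p : T) :
  is_tree e -> e v p -> branch e p v = ~: branch e v p.
Proof.
move=> treeT evp; have [symE _ _ _ _] := treeT.
have epv : e p v by rewrite symE.
have del_sym : symmetric (del_edge e v p).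
  by move=> x y; rewrite /del_edge /= symE setUC.
apply/setP => w; rewrite in_setC; apply/idP/idP => [wp|].
  apply: contra (branch_notin treeT evp); rewrite inE => vw; rewrite inE.
  apply: connect_trans vw _; rewrite (sym_connect_sym del_sym).
  move: wp; rewrite inE (eq_connect (e' := del_edge e v p)) // => x y.
  by rewrite /del_edge /= (setUC [set v]).
have [->|wv wNB] := eqVneq w v; first by rewrite branch_self.
have [u euv wu] := branch_cover treeT wv.
have [<- //|up] := eqVneq u p.
by case/negP: wNB; apply: (subsetP (proper_sub (branch_proper treeT euv up))).
Qed.

(** A vertex other than v lies in exactly one branch hanging from v: if it were
    in those of u and u', the first would be contained in B(v|u'), which is
    disjoint from B(u'|v). *)
Lemma sum_branches (T : finType) (e : rel T) (f : T -> nat) (v : T) :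
  is_tree e ->
  \sum_w f w = f v + \sum_(u | e u v) \sum_(w in branch e u v) f w.
Proof.
move=> treeT; have [symE _ _ _ _] := treeT.
rewrite (bigD1 v) //=; congr (_ + _).
rewrite (exchange_big_dep (predC1 v)) /=; last first.
  by move=> u w euv; apply: contraTneq => ->; apply: branch_notin.
apply: eq_bigr => w wv; have [u euv wu] := branch_cover treeT wv.
rewrite (big_pred1 u) // => u' /=; apply/andP/eqP => [[eu'v wu']|-> //].
apply/eqP; apply: contraTT wu' => u'u.
have := subsetP (proper_sub (branch_proper treeT euv (_ : u != u'))) w wu.
by rewrite (branch_compl treeT eu'v) inE; apply; rewrite eq_sym.
Qed.

Lemma sum_branch (T : finType) (e : rel T) (f : T -> nat) (v p : T) :
  is_tree e -> e v p ->
  \sum_(w in branch e v p) f w =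
  f v + \sum_(u | e u v && (u != p)) \sum_(w in branch e u v) f w.
Proof.
move=> treeT evp; have epv : e p v by case: treeT => ->.
have := sum_branches f v treeT.
rewrite (bigD1 p epv) (bigID [in branch e v p]) /= addnCA addnC.
rewrite (eq_bigl [in branch e p v]) => [/addnI //|w].
by rewrite (branch_compl treeT evp) !inE.
Qed.

(** Any walk from r into the branch at u enters it through the edge from v to
    u, so it contains a strictly shorter walk from r to v. *)
Lemma gdist_branch (T : finType) (e : rel T) (r u v : T) :
  is_tree e -> e u v -> r \notin branch e u v ->
  gdist e r u = (gdist e r v).+1.
Proof.
move=> treeT euv rB; have [symE _ _ conn _] := treeT.
have [[q [pq lq sq]] minv] := gdistP (conn r v).
have [[s [ps ls ss]] minu] := gdistP (conn r u).
have le_uv : gdist e r u <= (gdist e r v).+1.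
  have := minu (rcons q u); rewrite rcons_path last_rcons size_rcons pq lq sq.
  by rewrite symE euv; apply.
apply/eqP; rewrite eqn_leq le_uv -ss /=.
have sB : last r s \in branch e u v by rewrite ls branch_self.
suff [s1 [p1 l1 lt1]] :
    exists s1, [/\ path e r s1, last r s1 = v & size s1 < size s].
  exact: leq_ltn_trans (minv _ p1 l1) lt1.
elim: s r rB ps sB {q pq lq sq minv minu ls ss le_uv} => [|y s IHs] x xB /=.
  by move=> _ sB; rewrite sB in xB.
case/andP=> exy pys sB; have [yB|yB] := boolP (y \in branch e u v).
  exists [::]; split=> //=.
  have eyx : e y x by rewrite symE.
  by have [] := branch_exit treeT eyx yB xB.
have [s1 [p1 l1 lt1]] := IHs _ yB pys sB.
by exists (y :: s1); rewrite /= exy.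
Qed.

(** * The function F and the order modulo 3 *)

Local Open Scope ring_scope.

(** The order for which [Fmsg] is monotone; it is not monotone for the usual
    one, as F(2) = 1 and F(3) = 0. *)
Definition ge_mod3 (x y : int) : bool := (y <= x) && (3 %| x - y)%Z.

Lemma ge_mod3_shift (x y x' y' : int) :
  x - y = x' - y' -> ge_mod3 x y -> ge_mod3 x' y'.
Proof. by rewrite /ge_mod3; lia. Qed.

Lemma ge_mod3_sum (I : Type) (s : seq I) (P : pred I) (F G : I -> int) :
  (forall i, P i -> ge_mod3 (F i) (G i)) ->
  ge_mod3 (\sum_(i <- s | P i) F i) (\sum_(i <- s | P i) G i).
Proof.
by move=> FG; apply: (big_ind2 ge_mod3) => // x1 x2 y1 y2; rewrite /ge_mod3; lia.
Qed.

Lemma FmsgP (x : int) :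
  [\/ x <= 1 /\ Fmsg x = 2 * x - 3, 2 <= x /\ x = 2 * Fmsg x
    | 3 <= x /\ x = 2 * Fmsg x + 3].
Proof.
rewrite /Fmsg; case: ifP => [x1|x1]; first by constructor 1.
case: ifP => [even|odd]; first by constructor 2; lia.
by constructor 3; lia.
Qed.

Ltac Fmsg_lia x y :=
  rewrite /ge_mod3; move: (FmsgP x) (FmsgP y); move: (Fmsg x) (Fmsg y);
  move=> ? ? [[? ?]|[? ?]|[? ?]] [[? ?]|[? ?]|[? ?]] /andP[? /dvdzP[? ?]];
  apply/andP; split; lia.

Lemma Fmsg_homo (x y : int) : ge_mod3 x y -> ge_mod3 (Fmsg x) (Fmsg y).
Proof. Fmsg_lia x y. Qed.

(** Two more pebbles at a vertex are worth at least one more pebble sent. *)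
Lemma Fmsg_add2 (x y : int) : ge_mod3 x (y + 2) -> ge_mod3 (Fmsg x) (Fmsg y + 1).
Proof. Fmsg_lia x y. Qed.

(** Removing one pebble from a vertex costs at most two in the message sent. *)
Lemma Fmsg_sub1 (x y : int) : ge_mod3 x (y - 1) -> ge_mod3 (Fmsg x) (Fmsg y - 2).
Proof. Fmsg_lia x y. Qed.

(** For x <= 1 the value - F(x) = 3 - 2x is odd, and it is either 1 or at least
    3, where F undoes the doubling. *)
Lemma FmsgNK (x : int) : x <= 1 -> Fmsg (- Fmsg x) = - x.
Proof.
move: (FmsgP x); move: (Fmsg x) => y.
move=> [[? ->]|[? ?]|[? ?]] ?; [|lia|lia].
by move: (FmsgP (- (2 * x - 3))); move: (Fmsg (- (2 * x - 3))) => z [] []; lia.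
Qed.

(** * Scores decrease under moves *)

(** The argument of F in the message from v to p. Empty branches contribute 0
    to it, so the same sum is C(v) plus all messages except that of p, which
    links it to the score of v. *)
Definition inflow (T : finType) (e : rel T) (C : config T) (v p : T) : int :=
  (C v)%:Z + \sum_(u | e u v && (u != p)) message0 e C u v.

Lemma message_inflow (T : finType) (e : rel T) (C : config T) (v p : T) :
  is_tree e -> e v p -> message e C v p = Fmsg (inflow e C v p).
Proof.
move=> treeT evp; rewrite message_eq //; congr (Fmsg (_ + _)).
rewrite (eq_bigl (fun u => e u v && (u != p) && occupied e C u v)).
  by rewrite big_mkcondr.
by move=> u; rewrite andbA.
Qed.

Lemma score_inflow (T : finType) (e : rel T) (C : config T) (v p : T) :
  e p v -> score e C v = inflow e C v p + message0 e C p v.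
Proof. by move=> epv; rewrite /score (bigD1 p epv) /= addrCA addrC. Qed.

Lemma occupied_sub (T : finType) (e : rel T) (C : config T) (u v p : T) :
  is_tree e -> e u v -> u != p -> occupied e C u v -> occupied e C v p.
Proof.
move=> treeT euv up /exists_inP[x xu Cx]; apply/exists_inP; exists x => //.
exact: (subsetP (proper_sub (branch_proper treeT euv up))).
Qed.

Lemma inflow_empty (T : finType) (e : rel T) (C : config T) (v p : T) :
  is_tree e -> ~~ occupied e C v p -> inflow e C v p = 0.
Proof.
move=> treeT empty; rewrite /inflow big1 => [|u /andP[euv up]].
  have : ~~ (0 < C v)%N; last by case: (C v).
  by apply: contra empty => Cv; apply/exists_inP; exists v; rewrite ?branch_self.
rewrite /message0 ifF //; apply: contraNF empty; exact: occupied_sub.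
Qed.

(** The least drop in the message from v to p, at a move from a to b, that is
    wanted (a negative value allows a rise): if all messages dropped by exactly
    these amounts, no score would change. *)
Definition transfer (T : finType) (a b v p : T) : int :=
  if (v == a) && (p == b) then 1
  else if (v == b) && (p == a) then - 2 else 0.

Lemma transfer_sum (T : finType) (e : rel T) (C : config T) (a b v : T) :
  is_tree e -> e a b -> (2 <= C a)%N ->
  (C v)%:Z = (move C a b v)%:Z - \sum_(u | e u v) transfer a b u v.
Proof.
move=> treeT eab Ca; have [symE _ _ _ _] := treeT; have ab := tree_edge_neq treeT eab.
have eba : e b a by rewrite symE.
rewrite ffunE; have [->|va] := eqVneq v a.
  rewrite (bigD1 b eba) /= big1 /transfer => [|u /andP[_ ub]].
    by rewrite !eqxx (eq_sym b) (negPf ab) /=; lia.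
  by rewrite (negPf ub) (negPf ab) andbF.
have [->|vb] := eqVneq v b.
  rewrite (bigD1 a eab) /= big1 /transfer => [|u /andP[_ ua]].
    by rewrite !eqxx /=; lia.
  by rewrite (negPf ua) (eq_sym b) (negPf ab) andbF.
by rewrite big1 => [|u _]; rewrite ?subr0 // /transfer (negPf va) (negPf vb) !andbF.
Qed.

(** Induction on the branch. By [transfer_sum] the drops of all messages into v
    balance the change of C(v), so summing the induction hypothesis over the
    neighbours of v other than p leaves in the inflow only the term
    [transfer a b p v] of the reverse message: it is 0 off the edge ab, and on
    that edge [Fmsg_add2] and [Fmsg_sub1] convert it into the required
    bound. A branch that the move empties or fills has message 0, which is not F
    of its inflow; since that inflow is then 0, these cases are comparisons with
    F(2) = 1 and F(1) = -1. *)
Lemma message0_move (T : finType) (e : rel T) (C : config T) (a b v p : T) :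
  is_tree e -> e a b -> (2 <= C a)%N -> e v p ->
  ge_mod3 (message0 e C v p) (message0 e (move C a b) v p + transfer a b v p).
Proof.
move=> treeT eab Ca; have [symE _ _ _ _] := treeT.
have ab := tree_edge_neq treeT eab.
set D := move C a b.
have Db : (0 < D b)%N by rewrite ffunE eq_sym (negPf ab) eqxx addn1.
have [n] := ubnP #|branch e v p|; elim: n v p => // n IHn v p ltn evp.
have inflowCD : ge_mod3 (inflow e C v p) (inflow e D v p - transfer a b p v).
  have epv : e p v by rewrite symE.
  have : ge_mod3 (\sum_(u | e u v && (u != p)) message0 e C u v)
     (\sum_(u | e u v && (u != p)) (message0 e D u v + transfer a b u v)).
    apply: ge_mod3_sum => u /andP[euv up]; apply: IHn (euv).
    by rewrite (leq_trans (proper_card (branch_proper treeT euv up))).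
  apply: ge_mod3_shift; rewrite /inflow (transfer_sum v treeT eab Ca).
  by rewrite (bigD1 p epv) big_split /= -/D; ring.
(* The move leaves the branch. *)
have [/andP[/eqP va /eqP pb]|nab] := boolP ((v == a) && (p == b)).
  subst v p; rewrite {1}/transfer !eqxx /=.
  have occC : occupied e C a b.
    by apply/exists_inP; exists a; rewrite ?branch_self // (leq_trans _ Ca).
  rewrite {1}/message0 occC message_inflow //.
  rewrite /transfer !eqxx eq_sym (negPf ab) /= opprK in inflowCD.
  rewrite /message0; case: ifP => occD.
    by rewrite message_inflow //; apply: Fmsg_add2.
  rewrite (inflow_empty _ (negbT occD)) // in inflowCD.
  by have := Fmsg_homo inflowCD; rewrite (_ : Fmsg (0 + 2) = 0 + 1).
(* The move enters the branch. *)
have [/andP[/eqP vb /eqP pa]|nba] := boolP ((v == b) && (p == a)).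
  subst v p; rewrite /transfer (eq_sym b) (negPf ab) !eqxx /=.
  have occD : occupied e D b a.
    by apply/exists_inP; exists b; rewrite ?branch_self.
  rewrite /transfer !eqxx /= in inflowCD.
  rewrite /message0 occD (message_inflow D) //; case: ifP => occC.
    by rewrite message_inflow //; apply: Fmsg_sub1.
  rewrite inflow_empty ?occC // in inflowCD.
  have : ge_mod3 1 (inflow e D b a) by move: inflowCD; rewrite /ge_mod3; lia.
  move/Fmsg_homo; rewrite (_ : Fmsg 1 = -1) // /ge_mod3; lia.
(* The move does not cross vp, so the branch stays occupied or stays empty. *)
rewrite /transfer (andbC (p == a)) (andbC (p == b)) in inflowCD.
rewrite (negPf nab) (negPf nba) subr0 in inflowCD.
rewrite /transfer (negPf nab) (negPf nba) addr0.
have abB : (a \in branch e v p) = (b \in branch e v p).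
  apply/idP/idP => inB; apply: contraT => notB.
    have [E1 E2] := branch_exit treeT eab inB notB.
    by rewrite E1 E2 !eqxx in nab.
  have eba : e b a by rewrite symE.
  have [E1 E2] := branch_exit treeT eba inB notB.
  by rewrite E1 E2 !eqxx in nba.
have occCD : occupied e C v p = occupied e D v p.
  have [aB|aB] := boolP (a \in branch e v p).
    transitivity true; last symmetry; apply/exists_inP.
      by exists a => //; rewrite (leq_trans _ Ca).
    by exists b; rewrite -?abB.
  apply: eq_existsb => x; have [xB|] //= := boolP (x \in branch e v p).
  have xa : x != a by apply: contraNneq aB => <-.
  have xb : x != b by rewrite abB in aB; apply: contraNneq aB => <-.
  by rewrite ffunE (negPf xa) (negPf xb).
rewrite /message0 occCD; case: ifP => _ //.
by rewrite !message_inflow //; apply: Fmsg_homo.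
Qed.

Lemma score_move (T : finType) (e : rel T) (C : config T) (a b v : T) :
  is_tree e -> e a b -> (2 <= C a)%N ->
  ge_mod3 (score e C v) (score e (move C a b) v).
Proof.
move=> treeT eab Ca; have : ge_mod3 (\sum_(u | e u v) message0 e C u v)
   (\sum_(u | e u v) (message0 e (move C a b) u v + transfer a b u v)).
  by apply: ge_mod3_sum => u; apply: message0_move.
apply: ge_mod3_shift; rewrite /score (transfer_sum v treeT eab Ca) big_split /=.
by ring.
Qed.

Lemma score_reachable (T : finType) (e : rel T) (C D : config T) (v : T) :
  is_tree e -> reachable e C D -> score e D v <= score e C v.
Proof.
move=> treeT; elim=> {D} [//|D a b _ IH eab Da].
by have /andP[le _] := score_move v treeT eab Da; apply: le_trans le IH.
Qed.

Lemma score_stacked (T : finType) (e : rel T) (D : config T) (r : T) :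
  is_tree e -> stacked_at D r -> 0 < score e D r.
Proof.
move=> treeT /setP st; rewrite /score big1 => [|u eur].
  by have := st r; rewrite !inE eqxx; lia.
rewrite /message0; case: ifP => // /exists_inP[x xu Dx].
have := st x; rewrite !inE Dx => /esym/eqP xr.
by move: (branch_notin treeT eur); rewrite -{1}xr xu.
Qed.

Lemma nonstackable (T : finType) (e : rel T) (C : config T) :
  is_tree e -> (forall v, score e C v <= 0) -> ~ stackable e C.
Proof.
move=> treeT C0 [r [D [CD Dr]]].
by have := score_stacked treeT Dr; rewrite ltNge (le_trans (score_reachable r treeT CD)).
Qed.

(** * The root configuration *)

Local Open Scope nat_scope.

Lemma deg_gt0 (T : finType) (e : rel T) (v : T) :
  is_tree e -> 2 <= #|T| -> 0 < deg e v.
Proof.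
move=> treeT /card_gt1P[x [y [_ _ xy]]]; have [symE _ _ _ _] := treeT.
have [w wv] : exists w, w != v.
  by have [xv|] := eqVneq x v; [exists y; rewrite -xv eq_sym | exists x].
have [u euv _] := branch_cover treeT wv.
by apply/card_gt0P; exists u; rewrite inE symE.
Qed.

Lemma deg_other (T : finType) (e : rel T) (v p : T) :
  is_tree e -> e v p -> deg e v = #|[set u | e u v && (u != p)]|.+1.
Proof.
move=> treeT evp; have [symE _ _ _ _] := treeT.
rewrite /deg (cardsD1 p) inE evp; congr _.+1; apply: eq_card => u.
by rewrite !inE andbC symE.
Qed.

Definition weight (T : finType) (e : rel T) (r w : T) : nat :=
  if (w == r) || (1 < deg e w) then deg e w * 2 ^ gdist e r w else 0.

Lemma sigma_weight (T : finType) (e : rel T) (r : T) :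
  sigma e r = (\sum_w weight e r w).+1.
Proof. by rewrite /sigma add1n big_mkcond. Qed.

Lemma gdist_self (T : finType) (e : rel T) (r : T) : gdist e r r = 0.
Proof.
by apply/eqP; rewrite -leqn0; apply: (gdistP (connect0 e r)).2 [::] _ _.
Qed.

(** A branch contains r or a leaf of the tree: from any other vertex one can go
    on to a smaller branch inside it. *)
Lemma root_config_occupied (T : finType) (e : rel T) (r v p : T) :
  is_tree e -> 2 <= #|T| -> e v p -> occupied e (root_config e r) v p.
Proof.
move=> treeT cardT; have [n] := ubnP #|branch e v p|.
elim: n v p => // n IHn v p ltn evp.
suff : (v == r) || (deg e v == 1) \/ (exists2 u, e u v & u != p).
  case=> [vP|[u euv up]].
    apply/exists_inP; exists v; first exact: branch_self.
    rewrite ffunE; have [_|vr] := eqVneq v r; last first.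
      by move: vP; rewrite (negPf vr) /= => ->.
    rewrite sigma_weight subn1 /= (bigD1 r) //= /weight eqxx /=.
    by rewrite ltn_addr // muln_gt0 deg_gt0 // expn_gt0.
  apply: (occupied_sub treeT euv up); apply: IHn (euv).
  by rewrite (leq_trans (proper_card (branch_proper treeT euv up))).
rewrite (deg_other treeT evp) eqSS.
have [->|/set0Pn[u]] := eqVneq [set u | e u v && (u != p)] set0.
  by left; rewrite cards0 orbT.
by rewrite inE => /andP[euv up]; right; exists u.
Qed.

Lemma root_config_message0 (T : finType) (e : rel T) (r v p : T) :
  is_tree e -> 2 <= #|T| -> e v p ->
  message0 e (root_config e r) v p = message e (root_config e r) v p.
Proof. by move=> treeT cardT evp; rewrite /message0 root_config_occupied. Qed.

Local Open Scope ring_scope.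

(** The closed form of the message from v to p when r is not in the branch;
    the weights then count only vertices of degree more than 1. *)
Definition away_message (T : finType) (e : rel T) (r v p : T) : Prop :=
  (2 ^ gdist e r v)%:Z * message e (root_config e r) v p =
  - (2 ^ gdist e r v + 2 * \sum_(w in branch e v p) weight e r w)%N%:Z.

(** The vertices of A are one step further from r than v, so the factor 2 of
    their powers of 2 cancels against the 2 in front of the sum of weights. *)
Lemma sum_away_message (T : finType) (e : rel T) (r v : T) (A : {set T}) :
  is_tree e ->
  (forall u, u \in A ->
     [/\ e u v, r \notin branch e u v & away_message e r u v]) ->
  (2 ^ gdist e r v)%:Z * \sum_(u in A) message e (root_config e r) u v =
  - (#|A| * 2 ^ gdist e r v +
     \sum_(u in A) \sum_(w in branch e u v) weight e r w)%N%:Z.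
Proof.
move=> treeT msgA.
have E : 2 * ((2 ^ gdist e r v)%:Z * \sum_(u in A) message e (root_config e r) u v) =
    \sum_(u in A) - (2 * (2 ^ gdist e r v + \sum_(w in branch e u v) weight e r w))%N%:Z.
  rewrite mulrA mulr_sumr; apply: eq_bigr => u /msgA[euv ru].
  rewrite /away_message (gdist_branch treeT euv ru) expnS mulnDr => <-.
  by rewrite PoszM.
rewrite sumrN -(big_morph Posz PoszD (erefl 0%:Z)) in E.
have E2 : (\sum_(u in A) 2 * (2 ^ gdist e r v + \sum_(w in branch e u v) weight e r w) =
    2 * (#|A| * 2 ^ gdist e r v + \sum_(u in A) \sum_(w in branch e u v) weight e r w))%N.
  by rewrite -big_distrr big_split /= sum_nat_const.
rewrite E2 in E; lia.
Qed.

(** At a leaf the message is F(1) = -1. Elsewhere the inflow s is a sum of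
    negative messages, so F(s) = 2s - 3; with a children and k = 2^d(r,v),
    [sum_away_message] gives k (2s - 3) = -(2ak + 3k + ...), and
    2ak + 3k = k + 2 (a + 1) k is k plus twice the weight deg(v) k of v. *)
Lemma message_away (T : finType) (e : rel T) (r v p : T) :
  is_tree e -> (2 <= #|T|)%N -> e v p -> r \notin branch e v p ->
  away_message e r v p.
Proof.
move=> treeT cardT; have [n] := ubnP #|branch e v p|.
elim: n v p => // n IHn v p ltn evp rB.
have rv : v != r by apply: contraNneq rB => <-; apply: branch_self.
rewrite /away_message message_inflow // /inflow (sum_branch _ treeT evp).
set A := [set u | e u v && (u != p)].
have awayA u : u \in A -> [/\ e u v, r \notin branch e u v & away_message e r u v].
  rewrite inE => /andP[euv up]; have sub := branch_proper treeT euv up.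
  have ru := contra (subsetP (proper_sub sub) r) rB; split=> //.
  by apply: IHn => //; rewrite (leq_trans (proper_card sub)).
have := sum_away_message treeT awayA.
have -> : \sum_(u | e u v && (u != p)) message0 e (root_config e r) u v =
    \sum_(u in A) message e (root_config e r) u v.
  apply: eq_big => [u|u /andP[euv _]]; first by rewrite inE.
  by rewrite root_config_message0.
have -> : (\sum_(u | e u v && (u != p)) \sum_(w in branch e u v) weight e r w =
    \sum_(u in A) \sum_(w in branch e u v) weight e r w)%N.
  by apply: eq_bigl => u; rewrite inE.
have degA : deg e v = #|A|.+1 := deg_other treeT evp.
have weightv : weight e r v = (if 0 < #|A| then #|A|.+1 * 2 ^ gdist e r v else 0)%N.
  by rewrite /weight (negPf rv) degA.
rewrite ffunE (negPf rv) degA weightv eqSS.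
have [/cards0_eq -> _|Agt0] := posnP #|A|.
  by rewrite !big_set0 /= addr0 (_ : Fmsg 1 = - 1) ?addn0 ?mulrN1.
rewrite add0r.
have : (0 < 2 ^ gdist e r v)%N by rewrite expn_gt0.
move: (2 ^ _)%N (\sum_(u in A) message _ _ _ _) (\sum_(u in A) \sum_(w in _) _)%N.
move=> k s g k_gt0 ks; have s_le0 : s <= 0.
  by rewrite -(pmulr_rle0 (x := k%:Z)) // ks oppr_le0.
rewrite (_ : Fmsg s = 2 * s - 3); last by case: (FmsgP s); lia.
by rewrite mulrBr mulrCA ks; lia.
Qed.

Lemma score_root (T : finType) (e : rel T) (r : T) :
  is_tree e -> (2 <= #|T|)%N -> score e (root_config e r) r = 0.
Proof.
move=> treeT cardT; have [symE _ _ _ _] := treeT.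
set A := [set u | e r u].
have awayA u : u \in A -> [/\ e u r, r \notin branch e u r & away_message e r u r].
  rewrite inE symE => eur; have ru := branch_notin treeT eur.
  by split=> //; apply: message_away.
have := sum_away_message treeT awayA; rewrite gdist_self mul1r muln1 => msgA.
rewrite /score (eq_big [in A] (message e (root_config e r) ^~ r)); first last.
- by move=> u eur; rewrite root_config_message0.
- by move=> u; rewrite inE symE.
rewrite /= msgA ffunE eqxx sigma_weight subn1 /= (sum_branches _ r treeT).
rewrite {1}/weight eqxx gdist_self muln1 /=.
rewrite [X in (_ + X)%N](eq_bigl [in A]) ?subrr // => u.
by rewrite inE symE.
Qed.

(** The score of p being 0, the message from p to v is F(- m), where m = F(X) is
    the message from v to p and X its inflow; as m < 0 forces X <= 1, [FmsgNK]
    applies. *)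
Lemma score_away (T : finType) (e : rel T) (r v p : T) :
  is_tree e -> (2 <= #|T|)%N -> e v p -> r \notin branch e v p ->
  score e (root_config e r) p = 0 -> score e (root_config e r) v = 0.
Proof.
move=> treeT cardT evp rB; have [symE _ _ _ _] := treeT.
have epv : e p v by rewrite symE.
rewrite (score_inflow _ evp) (score_inflow _ epv) !root_config_message0 //.
have message_lt0 : message e (root_config e r) v p < 0.
  have k_gt0 : (0 < 2 ^ gdist e r v)%N by rewrite expn_gt0.
  rewrite -(pmulr_rlt0 (x := (2 ^ gdist e r v)%:Z)) //.
  by rewrite (message_away treeT cardT evp rB) oppr_lt0 ltz_nat ltn_addr.
rewrite (message_inflow _ treeT epv) => /eqP; rewrite addr_eq0 => /eqP ->.
rewrite message_inflow // in message_lt0 *; rewrite FmsgNK ?subrr //.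
by case: (FmsgP (inflow e (root_config e r) v p)); lia.
Qed.

Lemma score_root_config (T : finType) (e : rel T) (r v : T) :
  is_tree e -> (2 <= #|T|)%N -> score e (root_config e r) v = 0.
Proof.
move=> treeT cardT; have [symE _ _ _ _] := treeT.
have [n] := ubnP (gdist e r v); elim: n v => // n IHn v ltn.
have [->|vr] := eqVneq v r; first exact: score_root.
have [p epv rp] : exists2 p, e p v & r \in branch e p v.
  by apply: branch_cover; rewrite // eq_sym.
have evp : e v p by rewrite symE.
have rv : r \notin branch e v p by rewrite (branch_compl treeT epv) inE rp.
apply: (score_away treeT cardT evp rv); apply: IHn.
by rewrite (gdist_branch treeT evp rv) in ltn.
Qed.

Lemma mass_root_config (T : finType) (e : rel T) (r : T) :
  mass (root_config e r) = (estimator e r - 1)%N.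
Proof.
rewrite /mass (bigD1 r) //= ffunE eqxx /estimator -addnBAC; last first.
  by rewrite sigma_weight.
congr (_ + _)%N; rewrite /nleaves -sum1dep_card big_mkcondr /=.
by apply: eq_bigr => v vr; rewrite ffunE (negPf vr).
Qed.

Local Close Scope ring_scope.

Theorem theorem4p1 (T : finType) (e : rel T) (hT : is_tree e)
    (hcard : 2 <= #|T|) (r : T) :
  [/\ forall v : T, score e (root_config e r) v = 0%R,
      mass (root_config e r) = estimator e r - 1
    & ~ stackable e (root_config e r)].
Proof.
have score0 v := score_root_config r v hT hcard.
split=> //; first exact: mass_root_config.
by apply: nonstackable => // v; rewrite score0.
Qed.
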